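(* Let $a,b,c\in\mathbb{R}^p$. Then the $(b,c)$-inverse of $a$ exists if and only if $$b,\,c\in \mathbb{R}^p\odot c\odot a\odot b = c\odot a\odot b\odot\mathbb{R}^p .$$
   Context: $\mathbb{R}^p$ denotes the commutative ring with unity $(\mathbb{R}^p,+,\odot)$, where $+$ is entrywise addition and $a\odot b=\mathrm{circ}(a)\,b$, with $\mathrm{circ}(a)$ the circulant matrix whose first column is $a$; that is, $(a\odot b)_i=\sum_{j=1}^p a_{i-j+1}b_j$ with indices taken modulo $p$ in $\{1,\dots,p\}$. The unity is $(1,0,\dots,0)^T$. For $u,v\in\mathbb{R}^p$: $\mathbb{R}^p\odot u=\{x\odot u: x\in\mathbb{R}^p\}$, $u\odot\mathbb{R}^p=\{u\odot x:x\in\mathbb{R}^p\}$, and $u\odot\mathbb{R}^p\odot v=\{u\odot x\odot v:x\in\mathbb{R}^p\}$. An element $y\in\mathbb{R}^p$ is a $(b,c)$-inverse of $a$ if (a) $y\in (b\odot\mathbb{R}^p\odot y)\cap(y\odot\mathbb{R}^p\odot c)$, and (b) $y\odot a\odot b=b$ and $c\odot a\odot y=c$. *)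

(* Defs.v *)
From mathcomp Require Import all_boot all_order all_algebra.
From mathcomp Require Import classical_sets reals.

Set Implicit Arguments.
Unset Strict Implicit.
Unset Printing Implicit Defensive.

Import GRing.Theory.
Local Open Scope classical_set_scope.
Local Open Scope ring_scope.

(* R^p with p = n.+1 >= 1 is 'cV[R]_n.+1.  Its indices form 'I_n.+1, that is
   {0, ..., p - 1}, on which MathComp's subtraction is subtraction modulo p;
   the 1-based index i - j + 1 is thus the 0-based index i - j. *)
Definition circ (R : realType) (n : nat) (a : 'cV[R]_n.+1) : 'M[R]_n.+1 :=
  \matrix_(i, j) a (i - j) 0.

Definition cmul (R : realType) (n : nat) (a b : 'cV[R]_n.+1) : 'cV[R]_n.+1 :=
  circ a *m b.

Notation "a ⊙ b" := (cmul a b) (at level 40, left associativity) : ring_scope.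

Definition cone (R : realType) (n : nat) : 'cV[R]_n.+1 := delta_mx 0 0.

Definition lmultiples (R : realType) (n : nat) (u : 'cV[R]_n.+1) :
    set 'cV[R]_n.+1 :=
  [set z | exists x, z = x ⊙ u].

Definition rmultiples (R : realType) (n : nat) (u : 'cV[R]_n.+1) :
    set 'cV[R]_n.+1 :=
  [set z | exists x, z = u ⊙ x].

Definition lrmultiples (R : realType) (n : nat) (u v : 'cV[R]_n.+1) :
    set 'cV[R]_n.+1 :=
  [set z | exists x, z = u ⊙ x ⊙ v].

Definition bc_inverse (R : realType) (n : nat) (a b c y : 'cV[R]_n.+1) : Prop :=
  (lrmultiples b y `&` lrmultiples y c) y /\
  (y ⊙ a ⊙ b = b /\ c ⊙ a ⊙ y = c).

Lemma cmulE (R : realType) (n : nat) (a b : 'cV[R]_n.+1) i :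
  (a ⊙ b) i 0 = \sum_j a (i - j) 0 * b j 0.
Proof. by rewrite mxE; apply: eq_bigr => j _; rewrite mxE. Qed.

Lemma cmulC (R : realType) (n : nat) (a b : 'cV[R]_n.+1) : a ⊙ b = b ⊙ a.
Proof.
apply/colP => i; rewrite !cmulE (reindex_inj (subrI i)) /=.
by apply: eq_bigr => j _; rewrite subKr mulrC.
Qed.

Lemma cmulA (R : realType) (n : nat) (a b c : 'cV[R]_n.+1) :
  a ⊙ (b ⊙ c) = a ⊙ b ⊙ c.
Proof.
rewrite /cmul mulmxA; congr (_ *m _); apply/matrixP => i k.
rewrite !mxE (reindex_inj (addIr k)) /=.
by apply: eq_bigr => j _; rewrite !mxE addrK opprD addrA addrAC.
Qed.

Lemma cmul1 (R : realType) (n : nat) (a : 'cV[R]_n.+1) : cone R n ⊙ a = a.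
Proof.
rewrite cmulC; apply/colP => i; rewrite cmulE (bigD1 0) //= big1 => [|j /negPf j0].
  by rewrite mxE !eqxx mulr1 subr0 addr0.
by rewrite mxE j0 mulr0.
Qed.

Lemma cmulDr (R : realType) (n : nat) (a b c : 'cV[R]_n.+1) :
  a ⊙ (b + c) = a ⊙ b + a ⊙ c.
Proof. exact: mulmxDr. Qed.

(* Main.v *)
Require Import Defs.
From mathcomp Require Import all_boot all_order all_algebra.
From mathcomp Require Import classical_sets reals.

Local Open Scope classical_set_scope.
Local Open Scope ring_scope.

(** Put [m = c ⊙ a ⊙ b].  If [y] is a (b,c)-inverse, then absorbing [y] into
    the factorizations of [y] through [b] and through [c] exhibits [b] and [c]
    as multiples of [m]: [c = c ⊙ a ⊙ y] with [y = b ⊙ x ⊙ y], and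
    [b = y ⊙ a ⊙ b] with [y = y ⊙ z ⊙ c].

    Conversely, let [b = s ⊙ m] and [c = t ⊙ m].  The first identity reads
    [b = (s ⊙ c) ⊙ a ⊙ b], and the second reads [c = c ⊙ a ⊙ (b ⊙ t)], so
    [s ⊙ c] is a left candidate and [b ⊙ t] a right candidate for the inverse.
    Both equal [s ⊙ t ⊙ m] ([candidates_agree]), so their common value
    satisfies both absorption identities; being a multiple of [b] and of [c],
    it then inherits the two factorizations from those identities
    ([bc_inverse_of_multiples]).

    The equality of the left and right ideals of [m] is commutativity. *)

Lemma lmultiples_rmultiples (R : realType) (n : nat) (u : 'cV[R]_n.+1) :
  lmultiples u = rmultiples u.
Proof. by apply/seteqP; split=> z [x ->]; exists x; rewrite cmulC. Qed.

Lemma bc_inverse_lmultiples (R : realType) (n : nat) (a b c y : 'cV[R]_n.+1) :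
  bc_inverse a b c y ->
  lmultiples (c ⊙ a ⊙ b) b /\ lmultiples (c ⊙ a ⊙ b) c.
Proof.
move=> [[[x y_bx] [z y_zc]] [yab cay]]; split.
- by exists (y ⊙ z); rewrite !cmulA -y_zc yab.
- by exists (x ⊙ y); rewrite cmulC -(cmulA (c ⊙ a)) (cmulA b) -y_bx cay.
Qed.

(** The analogue of the equality of a left and a right inverse: here the
    generator [m] of the ideal containing [b] and [c] stands for the unity. *)
Lemma candidates_agree (R : realType) (n : nat) (b c m s t : 'cV[R]_n.+1) :
  b = s ⊙ m -> c = t ⊙ m -> s ⊙ c = b ⊙ t.
Proof. by move=> -> ->; rewrite -cmulA (cmulC m). Qed.

(** [s ⊙ c] absorbs [b] by the way [s] is given; it absorbs [c] only through
    its other form [b ⊙ t], which is why both multipliers are required. *)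
Lemma bc_inverse_of_multiples (R : realType) (n : nat)
    (a b c s t : 'cV[R]_n.+1) :
  b = s ⊙ (c ⊙ a ⊙ b) -> c = t ⊙ (c ⊙ a ⊙ b) -> bc_inverse a b c (s ⊙ c).
Proof.
move=> b_sm c_tm; have y_bt := candidates_agree _ _ _ _ _ _ _ b_sm c_tm.
have yab : s ⊙ c ⊙ a ⊙ b = b by rewrite {2}b_sm !cmulA.
have cay : c ⊙ a ⊙ (s ⊙ c) = c by rewrite y_bt cmulA cmulC -c_tm.
split; last by [].
split.
- (* [y = b ⊙ t] and [b = y ⊙ a ⊙ b] give [y = b ⊙ (t ⊙ a) ⊙ y]. *)
  exists (t ⊙ a); move: (s ⊙ c) y_bt yab {cay} => y y_bt yab.
  rewrite {1}y_bt -{1}yab (cmulC _ b) -!cmulA; congr (b ⊙ _).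
  by rewrite cmulC (cmulC a) -cmulA.
- (* [y = s ⊙ c] and [c = c ⊙ a ⊙ y] give [y = y ⊙ (a ⊙ s) ⊙ c]. *)
  by exists (a ⊙ s); rewrite -{1}cay !cmulA.
Qed.

Theorem theorem1 (R : realType) (n : nat) (a b c : 'cV[R]_n.+1) :
  (exists y : 'cV[R]_n.+1, bc_inverse a b c y) <->
  (lmultiples (c ⊙ a ⊙ b) b /\ lmultiples (c ⊙ a ⊙ b) c /\
   lmultiples (c ⊙ a ⊙ b) = rmultiples (c ⊙ a ⊙ b)).
Proof.
split=> [[y /bc_inverse_lmultiples [mb mc]] | [[s b_sm] [[t c_tm] _]]].
- by split; [|split=> //; exact: lmultiples_rmultiples].
- by exists (s ⊙ c); apply: bc_inverse_of_multiples b_sm c_tm.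
Qed.
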